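(* For $i=1,2,3$ let $G_i$ be an $r_i$-regular graph with $n_i\ge1$ vertices and $m_i$ edges, with $r_1\ge1$. Let $\theta_i$ ($1\le i\le n_1$), $\mu_j$ ($1\le j\le n_2$), $\eta_k$ ($1\le k\le n_3$) be the eigenvalues of $\mathcal L(G_1)$, $\mathcal L(G_2)$, $\mathcal L(G_3)$, respectively, each listed in non-increasing order with multiplicity (so $\theta_{n_1}=\mu_{n_2}=\eta_{n_3}=0$). Then the normalized Laplacian spectrum (multiset of eigenvalues of $\mathcal L(\mathfrak G)$) of $\mathfrak G=G_1^S\diamondsuit(G_2^V\cup G_3^E)$ consists of: (a) $\frac{2+r_2\mu_j}{r_2+2}$, repeated $m_1$ times, for each $j=1,2,\dots,n_2-1$; (b) $\frac{1+r_3\eta_k}{r_3+1}$, repeated $n_1$ times, for each $k=1,2,\dots,n_3-1$; (c) $1$, repeated $m_1-n_1$ times, and $\frac{2}{r_2+2}$, repeated $m_1-n_1$ times; (d) for each $i=1,2,\dots,n_1$, the four roots of the equation $$2(r_1n_2+n_3+r_1)((1+r_3)\lambda-1)((2+r_2)\lambda-2)(\lambda-1)^2-2n_3(\lambda-1)((2+r_2)\lambda-2)$$ $$-r_1(2-\theta_i)\big((2n_2+r_2+2)\lambda-2n_2-2\big)((1+r_3)\lambda-1)=0.$$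
   Context: All graphs are finite, simple and undirected. The normalized Laplacian matrix of $G$ is $\mathcal L(G)=I-D(G)^{-1/2}A(G)D(G)^{-1/2}$, where $A(G)$ is the adjacency matrix and $D(G)$ the diagonal degree matrix; rows and columns of $\mathcal L(G)$ indexed by isolated vertices are taken to be zero (e.g. $\mathcal L(K_1)=(0)$). If $m_1<n_1$ (which happens only for $r_1=1$), ''repeated $m_1-n_1$ times'' is read formally as a negative multiplicity: the corresponding values are removed $n_1-m_1$ times from the multiset given by the other items. The subdivision graph $S(G_1)$ is obtained by inserting a new vertex into every edge of $G_1$; its vertex set is $V(G_1)\cup I(G_1)$, where $I(G_1)$ is the set of inserted vertices, in bijection with the edges of $G_1$. The graph $G_1^S\diamondsuit(G_2^V\cup G_3^E)$ (subdivision vertex-edge neighbourhood edge-corona) consists of $S(G_1)$, $|I(G_1)|$ copies of $G_2$ and $|V(G_1)|$ copies of $G_3$, all vertex-disjoint, where for each $i$ every neighbour in $S(G_1)$ of the $i$-th vertex of $I(G_1)$ is joined to every vertex of the $i$-th copy of $G_2$, and for each $i$ the $i$-th vertex of $V(G_1)$ is joined to every vertex of the $i$-th copy of $G_3$. *)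

(* Defs.v *)
From mathcomp Require Import all_boot all_order all_algebra.

Set Implicit Arguments.
Unset Strict Implicit.
Unset Printing Implicit Defensive.

Import Order.TTheory GRing.Theory Num.Theory.

Local Open Scope ring_scope.

Record sgraph := SGraph {
  vertex :> finType;
  adj : rel vertex;
  adj_sym : symmetric adj;
  adj_irrefl : irreflexive adj }.

Definition degree (G : sgraph) (x : G) : nat := #|[set y | adj x y]|.

Definition regular (G : sgraph) (r : nat) : Prop := forall x : G, degree x = r.

Definition edges (G : sgraph) : {set {set G}} :=
  [set [set p.1; p.2] | p in [set p : G * G | adj p.1 p.2]].

Definition edge_type (G : sgraph) : finType := {A : {set G} | A \in edges G}.

Section Subdivision.
Variable G : sgraph.

(* [inl x] is an original vertex, [inr a] the vertex inserted into the edge [a]. *)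
Definition subdiv_adj (u v : G + edge_type G) : bool :=
  match u, v with
  | inl x, inr a => x \in val a
  | inr a, inl x => x \in val a
  | _, _ => false
  end.

Lemma subdiv_adj_sym : symmetric subdiv_adj.
Proof. by move=> [x|a] [y|b]. Qed.

Lemma subdiv_adj_irrefl : irreflexive subdiv_adj.
Proof. by move=> [x|a]. Qed.

Definition subdivision : sgraph := SGraph subdiv_adj_sym subdiv_adj_irrefl.

End Subdivision.

Section Corona.
Variables G1 G2 G3 : sgraph.

Definition corona_vertex : finType :=
  (subdivision G1 + (edge_type G1 * G2) + (G1 * G3))%type.

(* [inl (inl s)] is the vertex [s] of the subdivision graph of [G1],
   [inl (inr (a, p))] the vertex [p] of the copy of [G2] attached to the
   inserted vertex [a], and [inr (x, q)] the vertex [q] of the copy of [G3]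
   attached to the vertex [x] of [G1]. *)
Definition corona_adj (u v : corona_vertex) : bool :=
  match u, v with
  | inl (inl s), inl (inl t) => adj s t
  | inl (inl s), inl (inr (a, _)) => adj (inr a : subdivision G1) s
  | inl (inr (a, _)), inl (inl s) => adj (inr a : subdivision G1) s
  | inl (inr (a, p)), inl (inr (b, q)) => (a == b) && adj p q
  | inl (inl s), inr (x, _) => s == inl x
  | inr (x, _), inl (inl s) => s == inl x
  | inr (x, p), inr (y, q) => (x == y) && adj p q
  | _, _ => false
  end.

Lemma corona_adj_sym : symmetric corona_adj.
Proof.
move=> [[s|[a p]]|[x p]] [[t|[b q]]|[y q]] //=.
- exact: (@adj_sym (subdivision G1)).
- by rewrite eq_sym adj_sym.
- by rewrite eq_sym adj_sym.
Qed.

Lemma corona_adj_irrefl : irreflexive corona_adj.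
Proof.
move=> [[s|[a p]]|[x p]] /=; last 2 first.
- by rewrite adj_irrefl andbF.
- by rewrite adj_irrefl andbF.
exact: (@adj_irrefl (subdivision G1)).
Qed.

Definition corona : sgraph := SGraph corona_adj_sym corona_adj_irrefl.

End Corona.

Section Spectrum.
Variable R : rcfType.

Definition adj_mx (G : sgraph) : 'M[R]_#|G| :=
  \matrix_(i, j) (adj (enum_val i) (enum_val j))%:R.

(* Since [0^-1 = 0], the entry at an isolated vertex is 0. *)
Definition invsqrt_deg_mx (G : sgraph) : 'M[R]_#|G| :=
  diag_mx (\row_i (Num.sqrt (degree (enum_val i))%:R)^-1).

Definition isolated (G : sgraph) (x : G) : bool := degree x == 0%N.

Definition normalized_laplacian (G : sgraph) : 'M[R]_#|G| :=
  \matrix_(i, j)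
    if isolated (enum_val i) || isolated (enum_val j) then 0
    else (1%:M - invsqrt_deg_mx G *m adj_mx G *m invsqrt_deg_mx G) i j.

(* [s] lists all the roots of [p] with multiplicity; in particular [p] splits
   over [R]. *)
Definition roots_of (p : {poly R}) (s : seq R) : Prop :=
  p != 0 /\ p = lead_coef p *: \prod_(x <- s) ('X - x%:P).

Definition eigenvalues_of (n : nat) (A : 'M[R]_n) (s : seq R) : Prop :=
  roots_of (char_poly A) s.

(* The indeterminate ['X] plays the role of lambda. *)
Definition corona_quartic (r1 r2 r3 n2 n3 : nat) (theta : R) : {poly R} :=
  (2 * (r1%:R * n2%:R + n3%:R + r1%:R))%:P
    * ((1 + r3%:R)%:P * 'X - 1) * ((2 + r2%:R)%:P * 'X - 2%:P) * ('X - 1) ^+ 2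
  - (2 * n3%:R)%:P * ('X - 1) * ((2 + r2%:R)%:P * 'X - 2%:P)
  - (r1%:R * (2 - theta))%:P
    * ((2 * n2%:R + r2%:R + 2)%:P * 'X - (2 * n2%:R + 2)%:P)
    * ((1 + r3%:R)%:P * 'X - 1).

End Spectrum.

(* Main.v *)
Require Import Defs.
From mathcomp Require Import all_boot all_order all_algebra.
From mathcomp Require Import perm ring zify complex.

(** Every vertex of the corona has positive degree, so for each lambda the
    value at lambda of the characteristic polynomial of its normalized
    Laplacian is, up to the product of the degrees, the determinant of
    (lambda - 1) D + A ([char_poly_laplacian]).  This matrix is eliminated by
    blocks ([fdet_schur]).  Outside the vertices of G1 it is block diagonal:
    a scalar block on the inserted vertices, one block A(G2) + const per edge
    and one block A(G3) + const per vertex.  Because G2 and G3 are regular,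
    the eliminating vectors are constant on each copy, so the Schur complement
    on V(G1) only involves the incidence matrix B of G1, and B B^T = r1 + A(G1)
    makes it affine in A(G1) ([fdet_corona]).  For a regular graph
    det (t + c A) is read off from the normalized Laplacian eigenvalues
    ([fdet_regular]); the factors coming from the Schur complement are the
    quartics divided by a common cubic denominator.

    Clearing denominators and comparing away from the three poles gives an
    identity of polynomials ([char_poly_corona]): with nu = 2 / (r2 + 2),
    chi * ((X - 1)(X - nu))^n1 equals ((X - 1)(X - nu))^m1 times the factors of
    families (a) and (b) times the monic quartics.  The eigenvalue 0 of G2 and
    that of G3 are the ones absorbed by the denominators; the sorting
    hypotheses place them last, since the eigenvalues are nonnegative
    ([regular_last_eigenvalue]).

    The characteristic polynomial chi of a real symmetric matrix splits
    ([char_poly_sym_splits]); hence so do the quartics, which divide the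
    left-hand side.  Unique factorization then turns the identity into an
    equality of multisets, and cancelling the common copies of 1 and nu covers
    m1 >= n1 and m1 < n1 at once ([perm_eq_cancel_nseq]). *)

Set Implicit Arguments.
Unset Strict Implicit.
Unset Printing Implicit Defensive.

Import Order.TTheory GRing.Theory Num.Theory.

Local Open Scope ring_scope.

(** * Determinants indexed by finite types *)

(** The vertex sets below are sums and products of types; indexing by the type
    itself lets bijections between them act without casts on dimensions. *)
Definition fdet (K : comNzRingType) (T : finType) (f : T -> T -> K) : K :=
  \det (\matrix_(i < #|T|, j < #|T|) f (enum_val i) (enum_val j)).

Lemma eq_fdet (K : comNzRingType) (T : finType) (f g : T -> T -> K) :
  f =2 g -> fdet f = fdet g.
Proof. by move=> fg; congr (\det _); apply/matrixP => i j; rewrite !mxE fg. Qed.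

Lemma fdet_enum (K : comNzRingType) (T : finType) n (h : 'I_n -> T)
    (f : T -> T -> K) :
  bijective h -> fdet f = \det (\matrix_(i, j) f (h i) (h j)).
Proof.
move=> hbij; have nT : n = #|T| by rewrite -(bij_eq_card hbij) card_ord.
subst n; have inj : injective (enum_rank \o h).
  exact: (inj_comp enum_rank_inj (bij_inj hbij)).
pose s := perm inj.
transitivity (\det (row_perm s (col_perm s
   (\matrix_(i < #|T|, j < #|T|) f (enum_val i) (enum_val j))))).
  rewrite row_permE col_permE !det_mulmx !det_perm odd_permV /fdet.
  by rewrite mulrCA -expr2 sqrr_sign mulr1.
by congr (\det _); apply/matrixP => i j; rewrite !mxE !permE /= !enum_rankK.
Qed.

Lemma fdet_reindex (K : comNzRingType) (S T : finType) (h : S -> T)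
    (f : T -> T -> K) :
  bijective h -> fdet f = fdet (fun x y => f (h x) (h y)).
Proof.
move=> hbij; rewrite (@fdet_enum _ _ #|S| (h \o enum_val)) //.
exact/bij_comp/enum_val_bij.
Qed.

(** [X] plays the role of minus the inverse of the lower right block times the
    lower left one, but that block need not be invertible: adding the columns
    of T, weighted by [X], to those of S is unimodular and leaves an upper
    block triangular matrix. *)
Lemma fdet_schur (K : comNzRingType) (S T : finType)
    (f : S + T -> S + T -> K) (X : T -> S -> K) :
    (forall t s, f (inr t) (inl s) + \sum_u f (inr t) (inr u) * X u s = 0) ->
  fdet f =
    fdet (fun s s' => f (inl s) (inl s') + \sum_u f (inl s) (inr u) * X u s')
    * fdet (fun t t' => f (inr t) (inr t')).
Proof.
move=> elim_lower.
pose h (k : 'I_(#|S| + #|T|)) : S + T :=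
  match split k with inl i => inl (enum_val i) | inr j => inr (enum_val j) end.
pose h' (u : S + T) : 'I_(#|S| + #|T|) :=
  match u with inl s => lshift _ (enum_rank s) | inr t => rshift _ (enum_rank t) end.
have hl i : h (lshift _ i) = inl (enum_val i) by rewrite /h (unsplitK (inl i)).
have hr j : h (rshift _ j) = inr (enum_val j) by rewrite /h (unsplitK (inr j)).
have hbij : bijective h.
  exists h' => [k | [s|t]]; last 2 first.
  - by rewrite hl enum_rankK.
  - by rewrite hr enum_rankK.
  by rewrite -(splitK k); case: (split k) => i;
    rewrite /unsplit ?(hl, hr) /h' enum_valK.
rewrite (fdet_enum _ (h := h)) //.
set M := \matrix_(i, j) _.
pose Xm : 'M[K]_(#|T|, #|S|) := \matrix_(i, j) X (enum_val i) (enum_val j).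
pose E := block_mx 1%:M 0 Xm 1%:M : 'M[K]_(#|S| + #|T|).
have detE : \det E = 1 by rewrite det_lblock !det1 mulr1.
rewrite -[LHS]mulr1 -detE -det_mulmx -[M]submxK mulmx_block !mulmx1 !mulmx0 !add0r.
have -> : dlsubmx M + drsubmx M *m Xm = 0.
  apply/matrixP => i j; rewrite !mxE hl hr -[RHS](elim_lower (enum_val i) (enum_val j)).
  congr (_ + _); rewrite [RHS](reindex (@enum_val _ T)) /=; last first.
    exact/onW_bij/enum_val_bij.
  by apply: eq_bigr => k _; rewrite !mxE !hr.
rewrite det_ublock; congr (_ * _); congr (\det _); apply/matrixP => i j.
  rewrite !mxE !hl; congr (_ + _).
  rewrite [RHS](reindex (@enum_val _ T)) /=; last exact/onW_bij/enum_val_bij.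
  by apply: eq_bigr => k _; rewrite !mxE hl hr.
by rewrite !mxE !hr.
Qed.

Lemma fdet_lblock (K : comNzRingType) (S T : finType) (f : S + T -> S + T -> K) :
    (forall t s, f (inr t) (inl s) = 0) ->
  fdet f = fdet (fun s s' => f (inl s) (inl s'))
               * fdet (fun t t' => f (inr t) (inr t')).
Proof.
move=> f0; rewrite (fdet_schur (X := fun _ _ => 0)) => [|t s].
  by congr (_ * _); apply: eq_fdet => s s'; rewrite big1 ?addr0 // => u _; rewrite mulr0.
by rewrite f0 big1 ?addr0 // => u _; rewrite mulr0.
Qed.

Lemma fdet_card0 (K : comNzRingType) (T : finType) (f : T -> T -> K) :
  #|T| = 0%N -> fdet f = 1.
Proof.
rewrite /fdet => T0; move: (\matrix_(_, _) _); rewrite T0 => M; exact: det_mx00.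
Qed.

Lemma fdet_scalar (K : comNzRingType) (T : finType) (c : K) :
  fdet (fun x y : T => c *+ (x == y)) = c ^+ #|T|.
Proof.
rewrite -det_scalar; congr (\det _); apply/matrixP => i j.
by rewrite !mxE (inj_eq enum_val_inj).
Qed.

Lemma fdet_scale (K : comNzRingType) (T : finType) (c : K) f :
  fdet (fun x y : T => c * f x y) = c ^+ #|T| * fdet f.
Proof. by rewrite -detZ; congr (\det _); apply/matrixP => i j; rewrite !mxE. Qed.

(** Splitting off one index of S at a time turns the block diagonal matrix into
    a block triangular one with a smaller number of copies. *)
Lemma fdet_copies (K : comNzRingType) (S T : finType) (g : T -> T -> K) :
  fdet (fun u v : S * T => (u.1 == v.1)%:R * g u.2 v.2) = fdet g ^+ #|S|.
Proof.
have ord_copies n :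
  fdet (fun u v : 'I_n * T => (u.1 == v.1)%:R * g u.2 v.2) = fdet g ^+ n.
  elim: n => [|n IHn]; first by rewrite fdet_card0 // card_prod card_ord.
  pose h (u : T + 'I_n * T) : 'I_n.+1 * T :=
    match u with inl t => (ord0, t) | inr (i, t) => (lift ord0 i, t) end.
  pose h' (v : 'I_n.+1 * T) : T + 'I_n * T :=
    if unlift ord0 v.1 is Some i then inr (i, v.2) else inl v.2.
  rewrite (fdet_reindex _ (h := h)); last first.
    exists h' => [[t|[i t]] | [i t]]; rewrite /h' /= ?unlift_none ?liftK //.
    by case: unliftP => [j ->|->].
  rewrite fdet_lblock => [|[i t] t' /=]; last by rewrite mul0r.
  rewrite exprS -IHn; congr (_ * _); apply: eq_fdet.
    by move=> t t' /=; rewrite mul1r.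
  by move=> [i t] [j t'].
rewrite (fdet_reindex _ (h := fun u : 'I_#|S| * T => (enum_val u.1, u.2))).
  by rewrite -ord_copies; apply: eq_fdet => u v /=; rewrite (inj_eq enum_val_inj).
by exists (fun u => (enum_rank u.1, u.2)) => [[i t]|[s t]] /=;
  rewrite ?enum_valK ?enum_rankK.
Qed.

(** * Splitting of characteristic polynomials *)

(** Over the algebraically closed R[i] the polynomial splits; an eigenvector v
    of z satisfies z |v|^2 = v A v^* = z^* |v|^2 since A is Hermitian, so every
    root is real and the factorization descends to R. *)
Lemma char_poly_sym_splits (R : rcfType) n (A : 'M[R]_n) :
  A^T = A -> exists s : seq R, char_poly A = \prod_(x <- s) ('X - x%:P).
Proof.
move=> symA; pose toC := @real_complex R; pose AC := map_mx toC A.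
have AC_conj i j : (AC i j)^* = AC j i.
  rewrite !mxE.
  have -> : A j i = A i j by rewrite -[in LHS]symA mxE.
  by apply/CrealP/complex_realP; exists (A i j).
have [s Ds] := closed_field_poly_normal (char_poly AC).
rewrite (monicP (char_poly_monic _)) scale1r in Ds.
have s_real z : z \in s -> z \is Num.real.
  move=> sz; have /eigenvalueP[v vA v_neq0] : eigenvalue AC z.
    by rewrite eigenvalue_root_char Ds root_prod_XsubC.
  have vAE j : \sum_i v 0 i * AC i j = z * v 0 j.
    by move/rowP/(_ j): vA; rewrite !mxE.
  have vA'E i : \sum_j AC i j * (v 0 j)^* = z^* * (v 0 i)^*.
    rewrite -rmorphM -vAE rmorph_sum; apply: eq_bigr => j _.
    by rewrite rmorphM /= AC_conj mulrC.
  pose nv := \sum_i v 0 i * (v 0 i)^*.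
  have nv_neq0 : nv != 0.
    apply: contraNneq v_neq0 => nv0; apply/eqP/rowP => i; rewrite mxE.
    have pos j : true -> 0 <= v 0 j * (v 0 j)^* by rewrite mul_conjC_ge0.
    have /eqP : v 0 i * (v 0 i)^* = 0 by apply: (psumr_eq0P pos nv0).
    by rewrite mul_conjC_eq0 => /eqP.
  apply/CrealP; apply: (mulIf nv_neq0).
  transitivity (\sum_i v 0 i * \sum_j AC i j * (v 0 j)^*).
    by rewrite mulr_sumr; apply: eq_bigr => i _; rewrite vA'E mulrCA.
  under eq_bigr do rewrite mulr_sumr.
  rewrite exchange_big mulr_sumr; apply: eq_bigr => j _ /=.
  rewrite mulrA -vAE mulr_suml; apply: eq_bigr => i _; exact: mulrA.
exists [seq complex.Re z | z <- s]; apply: (map_poly_inj toC).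
rewrite map_char_poly -/AC Ds rmorph_prod big_map; apply: eq_big_seq => z sz.
by rewrite rmorphB /= map_polyX map_polyC /= /toC RRe_real // s_real.
Qed.

(** The product (p - q) s vanishes at every point of an infinite domain.  This
    allows identities of rational functions to be checked away from poles. *)
Lemma poly_eq_off_roots (R : numDomainType) (p q s : {poly R}) :
  s != 0 -> (forall x, s.[x] != 0 -> p.[x] = q.[x]) -> p = q.
Proof.
move=> s_neq0 pq; apply/eqP; rewrite -subr_eq0; apply/negPn/negP => pq_neq0.
pose d := (p - q) * s; have d_neq0 : d != 0 by rewrite mulf_neq0.
pose xs := [seq i%:R : R | i <- iota 0 (size d)].
have xs_uniq : uniq xs.
  by rewrite map_inj_uniq ?iota_uniq // => i j /eqP; rewrite eqr_nat => /eqP.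
have xs_roots : all (root d) xs.
  apply/allP => x _; rewrite /root !hornerE.
  by case: (eqVneq s.[x] 0) => [->|/pq->]; rewrite ?mulr0 // subrr mul0r.
by have := max_poly_roots d_neq0 xs_roots xs_uniq; rewrite size_map size_iota ltnn.
Qed.

Lemma horner_char_poly (K : comNzRingType) n (A : 'M[K]_n) x :
  (char_poly A).[x] = \det (x%:M - A).
Proof.
rewrite -horner_evalE -det_map_mx; congr (\det _); apply/matrixP => i j.
by rewrite !mxE /= horner_evalE !hornerE hornerMn hornerX.
Qed.

Lemma roots_of_horner (R : rcfType) (p : {poly R}) s x :
  roots_of p s -> p.[x] = lead_coef p * \prod_(y <- s) (x - y).
Proof.
case=> _ Dp; rewrite [in LHS]Dp hornerZ horner_prod.
by congr (_ * _); apply: eq_bigr => y _; rewrite !hornerE.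
Qed.

(** * Normalized Laplacians and regular graphs *)

Lemma size_eigenvalues (R : rcfType) n (A : 'M[R]_n) s :
  eigenvalues_of A s -> size s = n.
Proof.
case=> _ DA; apply: succn_inj; rewrite -(size_char_poly A) DA.
by rewrite (monicP (char_poly_monic _)) scale1r size_prod_XsubC.
Qed.

Lemma normalized_laplacianE (R : rcfType) (G : sgraph) i j :
    (forall x : G, degree x != 0%N) ->
  normalized_laplacian R G i j = (i == j)%:R
    - (Num.sqrt (degree (enum_val i))%:R)^-1 * (adj (enum_val i) (enum_val j))%:R
      * (Num.sqrt (degree (enum_val j))%:R)^-1.
Proof.
move=> deg_neq0; rewrite mxE /isolated !(negbTE (deg_neq0 _)) /=.
by rewrite /invsqrt_deg_mx mul_mx_diag mul_diag_mx !mxE.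
Qed.

Lemma normalized_laplacian_sym (R : rcfType) (G : sgraph) :
  (normalized_laplacian R G)^T = normalized_laplacian R G.
Proof.
apply/matrixP => i j; rewrite 2!mxE [in RHS]mxE orbC; case: ifP => // _.
rewrite /invsqrt_deg_mx !mul_mx_diag !mul_diag_mx !mxE eq_sym adj_sym.
by ring.
Qed.

Lemma sqrt_invK (R : rcfType) n :
  (Num.sqrt n%:R)^-1 * (Num.sqrt n%:R)^-1 = n%:R^-1 :> R.
Proof. by rewrite -invfM -expr2 sqr_sqrtr ?ler0n. Qed.

(** Multiplying lambda - L by D^(1/2) on both sides gives (lambda - 1) D + A,
    which is free of square roots. *)
Lemma char_poly_laplacian (R : rcfType) (G : sgraph) (x : R) :
    (forall v : G, degree v != 0%N) ->
  (char_poly (normalized_laplacian R G)).[x] * \prod_(v : G) (degree v)%:R =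
  fdet (fun u v : G => ((x - 1) * (degree u)%:R) *+ (u == v) + (adj u v)%:R).
Proof.
move=> deg_neq0; rewrite horner_char_poly.
pose D : 'M[R]_#|G| := diag_mx (\row_i Num.sqrt (degree (enum_val i))%:R).
have -> : \prod_(v : G) (degree v)%:R = \det D * \det D :> R.
  rewrite det_diag -big_split /= (reindex (@enum_val _ G)) /=; last first.
    exact/onW_bij/enum_val_bij.
  by apply: eq_bigr => i _; rewrite !mxE -expr2 sqr_sqrtr ?ler0n.
rewrite mulrCA mulrA -!det_mulmx; congr (\det _); apply/matrixP => i j.
have := normalized_laplacianE R i j deg_neq0.
move: (normalized_laplacian R G) => L LE.
rewrite /D mul_mx_diag mul_diag_mx !mxE {}LE.
have s_neq0 (k : 'I_#|G|) : Num.sqrt (degree (enum_val k))%:R != 0 :> R.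
  by rewrite sqrtr_eq0 -ltNge ltr0n lt0n deg_neq0.
rewrite (inj_eq enum_val_inj); case: eqVneq => [<-|_] /=; last first.
  by move: (s_neq0 i) (s_neq0 j) => ??; rewrite !mulr0n; field; apply/andP.
have := sqr_sqrtr (ler0n R (degree (enum_val i))).
move: (Num.sqrt _) (s_neq0 i) => s s0 <-.
by rewrite !mulr1n; field.
Qed.

Lemma sum_adj (R : pzRingType) (G : sgraph) (x : G) :
  \sum_y (adj x y)%:R = (degree x)%:R :> R.
Proof. by rewrite -natr_sum /degree cardsE -sum1_card [in RHS]big_mkcond. Qed.

Lemma regular0_adj (G : sgraph) (x y : G) : regular G 0 -> adj x y = false.
Proof.
move=> /(_ x) /eqP; rewrite cards_eq0 => /eqP deg0; have := in_set0 y.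
by rewrite -deg0 inE.
Qed.

(** When c r != 0 the matrix is c r ((t / (c r) + 1) - L), a value of the
    characteristic polynomial.  When c r = 0 the term c A vanishes, either by
    c = 0 or because the graph has no edge, and both sides are a power of t. *)
Lemma fdet_regular (R : rcfType) (G : sgraph) r (mu : seq R) (t c : R) :
    regular G r -> eigenvalues_of (normalized_laplacian R G) mu ->
  fdet (fun x y : G => t *+ (x == y) + c * (adj x y)%:R)
  = \prod_(m <- mu) (t + c * r%:R * (1 - m)).
Proof.
move=> regG hmu.
have sz_mu := size_eigenvalues hmu.
have [cr0|cr_neq0] := eqVneq (c * r%:R) 0.
  under [RHS]eq_bigr do rewrite cr0 mul0r addr0.
  rewrite big_const_seq count_predT sz_mu iter_mulr_1 -fdet_scalar.
  apply: eq_fdet => x y; move/eqP: cr0; rewrite mulf_eq0 pnatr_eq0.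
  case/orP=> [/eqP->|/eqP r0]; first by rewrite mul0r addr0.
  by rewrite regular0_adj ?mulr0 ?addr0 // -r0.
have /andP[c_neq0 r_neq0] : (c != 0) && (r%:R != 0 :> R) by rewrite -negb_or -mulf_eq0.
have deg_neq0 (v : G) : degree v != 0%N by rewrite regG -(pnatr_eq0 R).
have := char_poly_laplacian (t / (c * r%:R) + 1) deg_neq0.
rewrite (roots_of_horner _ hmu) (monicP (char_poly_monic _)) mul1r.
have -> : \prod_(v : G) (degree v)%:R = r%:R ^+ #|G| :> R.
  by rewrite -prodr_const; apply: eq_bigr => v _; rewrite regG.
move=> /(congr1 ( *%R (c ^+ #|G|))); rewrite -fdet_scale => fdetE.
transitivity (fdet (fun u v : G => c *
    (((t / (c * r%:R) + 1 - 1) * (degree u)%:R) *+ (u == v) + (adj u v)%:R))).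
  apply: eq_fdet => x y; rewrite regG mulrDr; congr (_ + _).
  have tE : t = c * ((t / (c * r%:R) + 1 - 1) * r%:R) by field; apply/andP.
  by case: (x == y) => /=; rewrite ?mulr0n ?mulr0 // !mulr1n.
rewrite -fdetE mulrCA -exprMn -sz_mu -[_ ^+ size mu]iter_mulr_1.
rewrite -[size mu]count_predT -big_const_seq -big_split /=.
by apply: eq_bigr => m _; field; apply/andP.
Qed.

(** Gershgorin-type bound: at a coordinate k where an eigenvector is largest in
    absolute value, the equation v A = r (1 - m) v forces r |1 - m| <= r. *)
Lemma regular_eigenvalue_ge0 (R : rcfType) (G : sgraph) r (m : R) :
  regular G r -> eigenvalue (normalized_laplacian R G) m -> 0 <= m.
Proof.
move=> regG /eigenvalueP[v vL v_neq0].
have [i vi_neq0] : exists i, v 0 i != 0.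
  apply/existsP; rewrite -negb_forall; apply: contra v_neq0 => /forallP v0.
  by apply/eqP/rowP => i; rewrite mxE; apply/eqP.
pose k := [arg max_(j > i) `|v 0 j|]%O.
have vk_max j : `|v 0 j| <= `|v 0 k|.
  by rewrite /k; case: arg_maxP => // k' _ /(_ j isT).
have vk_gt0 : 0 < `|v 0 k| by apply: lt_le_trans (vk_max i); rewrite normr_gt0.
have vLk : \sum_j v 0 j * normalized_laplacian R G j k = m * v 0 k.
  by move/rowP/(_ k): vL; rewrite !mxE.
have [r0|r_neq0] := eqVneq r 0%N.
  move: vLk; rewrite big1 => [/esym/eqP|j _].
    rewrite mulf_eq0 => /orP[/eqP->|/eqP vk0] //.
    by rewrite vk0 normr0 ltxx in vk_gt0.
  by rewrite mxE /isolated !regG r0 eqxx mulr0.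
have r_gt0 : 0 < r%:R :> R by rewrite ltr0n lt0n.
have deg_neq0 (u : G) : degree u != 0%N by rewrite regG.
have vA : \sum_(j < #|G|) v 0 j * (adj (enum_val j) (enum_val k))%:R
    = r%:R * (1 - m) * v 0 k.
  transitivity (r%:R * (v 0 k - \sum_j v 0 j * normalized_laplacian R G j k)); last first.
    by rewrite vLk; ring.
  have {1}-> : v 0 k = \sum_j v 0 j * (j == k)%:R.
    rewrite (bigD1 k) //= eqxx mulr1 big1 ?addr0 // => j /negbTE->.
    by rewrite mulr0.
  rewrite -sumrB mulr_sumr; apply: eq_bigr => j _.
  rewrite normalized_laplacianE // !regG [_ * _ / _]mulrAC sqrt_invK.
  by field; rewrite lt0r_neq0.
have : `|r%:R * (1 - m) * v 0 k| <= r%:R * `|v 0 k|.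
  rewrite -vA (le_trans (ler_norm_sum _ _ _)) //.
  rewrite -(regG (enum_val k)) -sum_adj mulr_suml.
  rewrite [leRHS](reindex (@enum_val _ G)) /=; last exact/onW_bij/enum_val_bij.
  apply: ler_sum => j _; rewrite normrM normr_nat adj_sym mulrC.
  by rewrite ler_wpM2l ?ler0n.
rewrite !normrM ler_pM2r // gtr0_norm // -ler_pdivlMl // mulVf ?lt0r_neq0 //.
by rewrite ler_norml => /andP[_]; rewrite lerBlDr lerDl.
Qed.

(** The constant vector is in the kernel. *)
Lemma regular_eigenvalue0 (R : rcfType) (G : sgraph) r (mu : seq R) :
    (0 < #|G|)%N -> regular G r ->
    eigenvalues_of (normalized_laplacian R G) mu ->
  0 \in mu.
Proof.
move=> G_gt0 regG hmu; have := roots_of_horner 0 hmu.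
suff : (char_poly (normalized_laplacian R G)).[0] == 0.
  rewrite (monicP (char_poly_monic _)) mul1r => /eqP-> /esym/eqP.
  by rewrite prodf_seq_eq0 => /hasP[m mu_m]; rewrite /= sub0r oppr_eq0 => /eqP<-.
change (root (char_poly (normalized_laplacian R G)) 0).
rewrite -eigenvalue_root_char; apply/eigenvalueP; exists (const_mx 1); last first.
  by apply/eqP => /rowP/(_ (Ordinal G_gt0)); rewrite !mxE => /eqP; rewrite oner_eq0.
rewrite scale0r; apply/rowP => k; rewrite !mxE.
under eq_bigr do rewrite mxE mul1r.
have [r0|r_neq0] := eqVneq r 0%N.
  by apply: big1 => j _; rewrite mxE /isolated !regG r0 eqxx.
have deg_neq0 (u : G) : degree u != 0%N by rewrite regG.
rewrite (eq_bigr (fun j : 'I_#|G| =>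
    (j == k)%:R - r%:R^-1 * (adj (enum_val j) (enum_val k))%:R)); last first.
  by move=> j _; rewrite normalized_laplacianE // !regG [_ * _ / _]mulrAC sqrt_invK.
rewrite sumrB -mulr_sumr.
have -> : \sum_(j < #|G|) (j == k)%:R = 1 :> R.
  by rewrite (bigD1 k) //= eqxx big1 ?addr0 // => j /negbTE->.
have -> : \sum_(j < #|G|) (adj (enum_val j) (enum_val k))%:R = r%:R :> R.
  rewrite -(regG (enum_val k)) -sum_adj; symmetry.
  rewrite (reindex (@enum_val _ G)) /=; last exact/onW_bij/enum_val_bij.
  by apply: eq_bigr => j _; rewrite adj_sym.
by rewrite mulVf ?subrr // pnatr_eq0.
Qed.

Lemma regular_last_eigenvalue (R : rcfType) (G : sgraph) r (mu : seq R) :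
    (0 < #|G|)%N -> regular G r ->
    eigenvalues_of (normalized_laplacian R G) mu -> sorted >=%R mu ->
  last 0 mu = 0.
Proof.
move=> G_gt0 regG hmu mu_sorted.
have mu0 := regular_eigenvalue0 G_gt0 regG hmu.
have mu_ge0 m : m \in mu -> 0 <= m.
  move=> mu_m; apply: (regular_eigenvalue_ge0 regG).
  case: hmu => _; rewrite eigenvalue_root_char => ->.
  by rewrite (monicP (char_poly_monic _)) scale1r root_prod_XsubC.
case/lastP: mu => [//|mu m] in mu_sorted mu0 mu_ge0 {hmu} *.
rewrite last_rcons; apply/eqP; rewrite eq_le mu_ge0 ?mem_rcons ?mem_head // andbT.
move: mu0; rewrite mem_rcons inE => /orP[/eqP<-//|mu0].
move: mu_sorted; rewrite (sorted_pairwise ge_trans) pairwise_rcons.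
by case/andP=> /allP/(_ 0 mu0).
Qed.

(** * Vertex-edge incidence *)

Lemma sum_pred1 (R : pzRingType) (T : finType) (x : T) (F : T -> R) :
  \sum_y (x == y)%:R * F y = F x.
Proof.
rewrite (bigD1 x) //= eqxx mul1r big1 ?addr0 // => y.
by rewrite eq_sym => /negbTE->; rewrite mul0r.
Qed.

Section Incidence.
Variables (R : pzRingType) (G : sgraph).

Lemma edgeP (A : {set G}) :
  reflect (exists x y, adj x y /\ A = [set x; y]) (A \in edges G).
Proof.
apply: (iffP imsetP) => [[[x y]]|[x [y [xy ->]]]].
  by rewrite inE /= => xy ->; exists x, y.
by exists (x, y); rewrite ?inE.
Qed.

Lemma card_edge_type : #|edge_type G| = #|edges G|.
Proof. by rewrite card_sig. Qed.

Lemma sum_edge_ends (e : edge_type G) : \sum_x (x \in val e)%:R = 2 :> R.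
Proof.
case: e => A /= /edgeP[x [y [xy ->]]].
transitivity (#|[set x; y]|%:R : R).
  by rewrite -sum1_card natr_sum [RHS]big_mkcond; apply: eq_bigr => z _; case: ifP.
by rewrite cards2; case: eqVneq xy => // ->; rewrite adj_irrefl.
Qed.

Lemma edge_pairE (e : edge_type G) (x y : G) :
  x != y -> (x \in val e) && (y \in val e) = (val e == [set x; y]).
Proof.
move=> xy; apply/andP/eqP => [[xe ye]|->]; last by rewrite !inE !eqxx orbT.
apply/esym/eqP; rewrite eqEcard subUset !sub1set xe ye cards2 xy /=.
by case/edgeP: (valP e) => u [v [_ ->]]; rewrite cards2; case: (u != v).
Qed.

Lemma sum_edges_through_pair (x y : G) : x != y ->
  \sum_(e : edge_type G) (x \in val e)%:R * (y \in val e)%:R = (adj x y)%:R :> R.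
Proof.
move=> xy.
transitivity (\sum_(e : edge_type G) (val e == [set x; y])%:R : R).
  by apply: eq_bigr => e _; rewrite -natrM mulnb edge_pairE.
case: (boolP ([set x; y] \in edges G)) => [exy|nexy].
  have -> : adj x y.
    case/edgeP: exy => u [v [uv xyE]].
    have := set21 x y; have := set22 x y; rewrite xyE !inE.
    move=> /orP[]/eqP yE /orP[]/eqP xE; rewrite ?xE ?yE ?(adj_sym v) //;
      by rewrite xE yE eqxx in xy.
  pose exy' : edge_type G :=
    exist (fun A : {set G} => A \in edges G) _ exy.
  rewrite (bigD1 exy') //= eqxx big1 ?addr0 // => e.
  by rewrite -val_eqE /= => /negbTE->.
have -> : adj x y = false.
  by apply: contraNF nexy => xy_adj; apply/edgeP; exists x, y.
rewrite big1 // => e _; case: eqP => // exy.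
by move: nexy; rewrite -exy (valP e).
Qed.

(** As an edge has two ends, it contains x exactly when it contains x and one
    other vertex; this reduces the count to pairs. *)
Lemma sum_edges_at (x : G) :
  \sum_(e : edge_type G) (x \in val e)%:R = (degree x)%:R :> R.
Proof.
have atE (e : edge_type G) :
    (x \in val e)%:R = \sum_(y | y != x) (x \in val e)%:R * (y \in val e)%:R :> R.
  rewrite -mulr_sumr; have := sum_edge_ends e; rewrite (bigD1 x) //=.
  case: (x \in val e); last by rewrite mul0r.
  by rewrite mul1r (natrD R 1 1) => /addrI.
under eq_bigr do rewrite atE.
rewrite exchange_big /= -sum_adj [RHS](bigD1 x) //= adj_irrefl add0r.
by apply: eq_bigr => y yx; rewrite sum_edges_through_pair // eq_sym.
Qed.

(** This is the identity B B^T = D + A for the vertex-edge incidence matrix. *)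
Lemma sum_edges_through (x y : G) :
  \sum_(e : edge_type G) (x \in val e)%:R * (y \in val e)%:R
  = (degree x)%:R *+ (x == y) + (adj x y)%:R :> R.
Proof.
case: eqVneq => [<-|xy]; last by rewrite mulr0n add0r sum_edges_through_pair.
rewrite adj_irrefl mulr1n addr0 -sum_edges_at.
by apply: eq_bigr => e _; case: (x \in val e); rewrite ?mulr1 ?mulr0.
Qed.

End Incidence.

(** * Elimination in the corona *)

Section CoronaDegree.
Variables (R : rcfType) (G1 G2 G3 : sgraph) (r1 r2 r3 : nat).
Hypotheses (hr1 : regular G1 r1) (hr2 : regular G2 r2) (hr3 : regular G3 r3).

Let C := corona G1 G2 G3.

Lemma sum_corona (F : C -> R) : \sum_v F v =
  \sum_x F (inl (inl (inl x))) + \sum_e F (inl (inl (inr e)))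
  + \sum_e \sum_p F (inl (inr (e, p))) + \sum_x \sum_q F (inr (x, q)).
Proof.
rewrite /C /= /corona_vertex !big_sumType /=; congr (_ + _ + _ + _).
  by rewrite pair_big /=; apply: eq_bigr => -[].
by rewrite pair_big /=; apply: eq_bigr => -[].
Qed.

Definition corona_degree (v : C) : R :=
  match v with
  | inl (inl (inl _)) => r1%:R * #|G2|%:R + #|G3|%:R + r1%:R
  | inl (inl (inr _)) => 2
  | inl (inr _) => r2%:R + 2
  | inr _ => r3%:R + 1
  end.

Lemma degree_corona (v : C) : (degree v)%:R = corona_degree v.
Proof.
rewrite -sum_adj sum_corona; case: v => [[[x|e]|[e p]]|[x q]] /=.
- rewrite big1 // add0r sum_edges_at hr1.
  rewrite [X in _ + X + _](_ : _ = r1%:R * #|G2|%:R); last first.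
    under eq_bigr do rewrite sumr_const -[_ *+ #|_|]mulr_natr.
    by rewrite -mulr_suml sum_edges_at hr1.
  rewrite [X in _ + X](_ : _ = #|G3|%:R); last first.
    under eq_bigr do rewrite sumr_const -[_ *+ #|_|]mulr_natr.
    exact: (sum_pred1 x (fun=> #|G3|%:R)).
  by ring.
- rewrite sum_edge_ends !big1 ?addr0 // => *; exact: big1.
- rewrite sum_edge_ends big1 // addr0 [X in _ + X]big1 ?addr0; last first.
    by move=> *; exact: big1.
  under eq_bigr => e' _.
    under eq_bigr do rewrite -mulnb natrM.
    rewrite -mulr_sumr; over.
  by rewrite sum_pred1 sum_adj hr2 addrC.
rewrite [X in _ + X + _ + _]big1 // addr0 [X in _ + X + _]big1 ?addr0; last first.
  by move=> *; exact: big1.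
under [X in _ + X]eq_bigr => x' _.
  under eq_bigr do rewrite -mulnb natrM.
  rewrite -mulr_sumr; over.
rewrite sum_pred1 sum_adj hr3 addrC; congr (_ + _).
transitivity (\sum_y (x == y)%:R * 1 : R); last by rewrite sum_pred1.
by apply: eq_bigr => y _; rewrite mulr1 eq_sym.
Qed.

(** Here a stands for lambda - 1.  The copies of G2 and G3 are eliminated with
    vectors constant on each copy, which their all-ones eigenvector makes
    possible: b2 and b3 are the row sums of the blocks a (r2 + 2) + A(G2) and
    a (r3 + 1) + A(G3). *)
Lemma fdet_corona (theta mu eta : seq R) (a : R)
    (d := r1%:R * #|G2|%:R + #|G3|%:R + r1%:R : R)
    (b2 := a * (r2%:R + 2) + r2%:R) (b3 := a * (r3%:R + 1) + r3%:R) :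
    eigenvalues_of (normalized_laplacian R G1) theta ->
    eigenvalues_of (normalized_laplacian R G2) mu ->
    eigenvalues_of (normalized_laplacian R G3) eta ->
    a != 0 -> b2 != 0 -> b3 != 0 ->
  fdet (fun u v : C => (a * (degree u)%:R) *+ (u == v) + (adj u v)%:R) =
    \prod_(t <- theta) (a * d - #|G3|%:R / b3
                        - ((2 * a)^-1 + #|G2|%:R / b2) * r1%:R * (2 - t))
    * ((2 * a) ^+ #|edges G1|
       * ((\prod_(m <- mu) (a * (r2%:R + 2) + r2%:R * (1 - m))) ^+ #|edges G1|
          * (\prod_(m <- eta) (a * (r3%:R + 1) + r3%:R * (1 - m))) ^+ #|G1|)).
Proof.
move=> htheta hmu heta a_neq0 b2_neq0 b3_neq0.
pose rest := (edge_type G1 + (edge_type G1 * G2 + G1 * G3))%type.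
(* Reassociate the vertex type so that V(G1) is the first summand. *)
pose h (u : G1 + rest) : C :=
  match u with
  | inl x => inl (inl (inl x))
  | inr (inl e) => inl (inl (inr e))
  | inr (inr (inl ep)) => inl (inr ep)
  | inr (inr (inr xq)) => inr xq
  end.
pose h' (v : C) : G1 + rest :=
  match v with
  | inl (inl (inl x)) => inl x
  | inl (inl (inr e)) => inr (inl e)
  | inl (inr ep) => inr (inr (inl ep))
  | inr xq => inr (inr (inr xq))
  end.
have hbij : bijective h.
  by exists h' => [[x|[e|[ep|xq]]]|[[[x|e]|ep]|xq]].
rewrite (fdet_reindex _ hbij).
(* Each value is minus the adjacency to V(G1) divided by the row sum of the
   diagonal block: 2 a for an inserted vertex, b2 or b3 in a copy. *)
pose back (u : rest) (y : G1) : R :=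
  match u with
  | inl e => - (y \in val e)%:R / (2 * a)
  | inr (inl (e, _)) => - (y \in val e)%:R / b2
  | inr (inr (x, _)) => - (x == y)%:R / b3
  end.
have sum_rest (F : rest -> R) : \sum_u F u = \sum_e F (inl e)
    + (\sum_e \sum_p F (inr (inl (e, p))) + \sum_x \sum_q F (inr (inr (x, q)))).
  rewrite !big_sumType /=; congr (_ + (_ + _)).
    by rewrite pair_big /=; apply: eq_bigr => -[].
  by rewrite pair_big /=; apply: eq_bigr => -[].
have sum_copy (T : finType) (H : sgraph) (e : T) (p : H) (b : R) (c : T -> R) r :
    regular H r ->
    \sum_e' \sum_q (b *+ ((e, p) == (e', q)) + ((e == e') && adj p q)%:R) * c e'
    = (b + r%:R) * c e.
  move=> hr; transitivity (\sum_e' (e == e')%:R * ((b + r%:R) * c e')).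
    apply: eq_bigr => e' _; rewrite -mulr_suml mulrA; congr (_ * _).
    rewrite mulrDr big_split /=; congr (_ + _).
      transitivity (\sum_q (p == q)%:R * ((e == e')%:R * b) : R).
        apply: eq_bigr => q _; rewrite xpair_eqE.
        by case: (e == e'); case: (p == q); rewrite /= ?mulr1n ?mulr0n; ring.
      exact: sum_pred1.
    under eq_bigr do rewrite -mulnb natrM.
    by rewrite -mulr_sumr sum_adj hr.
  exact: sum_pred1.
rewrite (fdet_schur (X := back)); last first.
  move=> u y; rewrite sum_rest; case: u => [e|[[e p]|[x q]]] /=;
    rewrite degree_corona /= mulr0n add0r.
  - rewrite [X in _ + (_ + X) = _](_ : _ = 0); last first.
      by rewrite !big1 ?addr0 // => ? _; rewrite big1 // => ? _;
        rewrite ?mulr0n ?add0r mul0r.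
    rewrite [X in _ + (X + _) = _](_ : _ =
        \sum_e' (e == e')%:R * (a * 2 * (- (y \in val e')%:R / (2 * a)))).
      by rewrite sum_pred1 /=; field.
    apply: eq_bigr => e' _; rewrite addr0 -[inl _ == inl _]/(e == e').
    by case: (e == e'); rewrite ?mulr1n ?mulr0n ?mul1r ?mul0r.
  - rewrite big1 => [|e' _]; last by rewrite ?mulr0n ?add0r mul0r.
    rewrite add0r [X in _ + (_ + X) = _](_ : _ = 0); last first.
      by rewrite big1 // => ? _; rewrite big1 // => ? _; rewrite ?mulr0n ?add0r mul0r.
    rewrite addr0 (sum_copy _ _ e p _ (fun e' => - (y \in val e')%:R / b2) _ hr2).
    by rewrite -/b2 /=; field.
  rewrite big1 => [|e' _]; last by rewrite ?mulr0n ?add0r mul0r.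
  rewrite add0r [X in _ + (X + _) = _](_ : _ = 0); last first.
    by rewrite big1 // => ? _; rewrite big1 // => ? _; rewrite ?mulr0n ?add0r mul0r.
  rewrite add0r (sum_copy _ _ x q _ (fun x' => - (x' == y)%:R / b3) _ hr3).
  by rewrite -[inl y == inl x]/(y == x) eq_sym -/b3; field.
congr (_ * _).
  pose c := (2 * a)^-1 + #|G2|%:R / b2.
  transitivity (\prod_(t <- theta)
      (a * d - #|G3|%:R / b3 - c * r1%:R + - c * r1%:R * (1 - t))); last first.
    by apply: eq_bigr => t _; rewrite /c; ring.
  rewrite -(fdet_regular _ _ hr1 htheta); apply: eq_fdet => x y.
  rewrite sum_rest /= degree_corona /= -[inl _ == inl _]/(x == y) -/d.
  have sumE : \sum_(e : edge_type G1) (x \in val e)%:R * (y \in val e)%:R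
      = r1%:R *+ (x == y) + (adj x y)%:R :> R by rewrite sum_edges_through hr1.
  rewrite [X in _ + (X + _) = _](_ : _ =
      - (2 * a)^-1 * \sum_(e : edge_type G1)
          (x \in val e)%:R * (y \in val e)%:R); last first.
    by rewrite mulr_sumr; apply: eq_bigr => e _; rewrite ?mulr0n ?add0r; ring.
  rewrite [X in _ + (_ + (X + _)) = _](_ : _ =
      - (#|G2|%:R / b2) * \sum_(e : edge_type G1)
          (x \in val e)%:R * (y \in val e)%:R); last first.
    rewrite mulr_sumr; apply: eq_bigr => e _; rewrite ?mulr0n ?add0r.
    by rewrite sumr_const -[_ *+ #|_|]mulr_natr; ring.
  rewrite [X in _ + (_ + (_ + X)) = _](_ : _ = - (#|G3|%:R / b3) *+ (x == y)); last first.
    transitivity (\sum_z (x == z)%:R * (- (#|G3|%:R / b3) *+ (z == y)));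
      last exact: sum_pred1.
    apply: eq_bigr => z _; rewrite ?mulr0n ?add0r.
    rewrite sumr_const -[_ *+ #|_|]mulr_natr -[inl _ == inl _]/(x == z).
    by case: (z == y); rewrite ?mulr1n ?mulr0n; ring.
  rewrite sumE /c; case: (x == y); rewrite ?mulr1n ?mulr0n; ring.
have copiesE (T : finType) (H : sgraph) (ev : seq R) r b :
    regular H r -> eigenvalues_of (normalized_laplacian R H) ev ->
    fdet (fun u v : T * H => b *+ (u == v) + ((u.1 == v.1) && adj u.2 v.2)%:R)
    = (\prod_(m <- ev) (b + r%:R * (1 - m))) ^+ #|T|.
  move=> hr hev; under eq_bigr do rewrite -[r%:R]mul1r.
  rewrite -(fdet_regular _ _ hr hev) -fdet_copies; apply: eq_fdet => -[e p] [e' q] /=.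
  rewrite xpair_eqE; case: (e == e'); rewrite ?mul1r ?mul0r ?addr0 ?mulr0n //=.
rewrite -card_edge_type -(copiesE _ _ _ _ _ hr2 hmu) -(copiesE _ _ _ _ _ hr3 heta).
rewrite -fdet_scalar !fdet_lblock; last first.
- by move=> [[e p]|[x q]] e'; rewrite /= ?mulr0n ?add0r.
- by move=> [e p] [x q]; rewrite /= ?mulr0n ?add0r.
congr (_ * (_ * _)); apply: eq_fdet.
- by move=> e e'; rewrite degree_corona /= addr0 [a * 2]mulrC.
- by move=> [e p] [e' q]; rewrite degree_corona /=.
- by move=> [e p] [e' q]; rewrite degree_corona /=.
Qed.
End CoronaDegree.

(** * The quartics and the polynomial identity *)

Definition quartic_lead (R : rcfType) (r1 r2 r3 n2 n3 : nat) : R :=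
  2 * (r1%:R * n2%:R + n3%:R + r1%:R) * (1 + r3%:R) * (2 + r2%:R).

Lemma quartic_lead_neq0 (R : rcfType) r1 r2 r3 n2 n3 :
  (0 < r1)%N -> quartic_lead R r1 r2 r3 n2 n3 != 0.
Proof.
move=> r1_gt0; rewrite /quartic_lead nat1r -!natrM -!natrD -!natrM pnatr_eq0 -lt0n.
by rewrite !muln_gt0 /= !addn_gt0 r1_gt0 !orbT.
Qed.

(** Only the first product has degree 4; the remaining terms are collected in an
    explicit cubic. *)
Lemma size_lead_corona_quartic (R : rcfType) r1 r2 r3 n2 n3 (t : R) :
  (0 < r1)%N ->
  size (corona_quartic r1 r2 r3 n2 n3 t) = 5%N /\
  lead_coef (corona_quartic r1 r2 r3 n2 n3 t) = quartic_lead R r1 r2 r3 n2 n3.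
Proof.
move=> r1_gt0; have lead_neq0 := quartic_lead_neq0 R r2 r3 n2 n3 r1_gt0.
pose d : R := 2 * (r1%:R * n2%:R + n3%:R + r1%:R).
pose b : R := 1 + r3%:R; pose g : R := 2 + r2%:R.
pose c : R := r1%:R * (2 - t); pose u : R := 2 * n2%:R + r2%:R + 2.
pose v : R := 2 * n2%:R + 2.
pose cubic : {poly R} := Poly [:: 2 * d - 4 * n3%:R - c * v;
   - d * (2 * b + g + 4) + 2 * n3%:R * (g + 2) + c * (u + v * b);
   d * (b * g + 2 * (2 * b + g) + 2) - 2 * n3%:R * g - c * u * b;
   - d * (2 * b * g + 2 * b + g)].
have -> : corona_quartic r1 r2 r3 n2 n3 t
    = quartic_lead R r1 r2 r3 n2 n3 *: 'X^4 + cubic.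
  rewrite /corona_quartic /quartic_lead /cubic /= !cons_poly_def -mul_polyC.
  rewrite /u /v /c /d /b /g; ring.
have sz4 : size (quartic_lead R r1 r2 r3 n2 n3 *: 'X^4) = 5%N.
  by rewrite size_scale // size_polyXn.
have szc : (size cubic < size (quartic_lead R r1 r2 r3 n2 n3 *: 'X^4 : {poly R}))%N.
  by rewrite sz4; apply: leq_ltn_trans (size_Poly _) _.
by rewrite size_polyDl // lead_coefDl // lead_coefZ lead_coefXn mulr1.
Qed.

Lemma prodZ_seq (K : comNzRingType) (I : Type) (s : seq I) (c : K) (F : I -> K) :
  \prod_(i <- s) (c * F i) = c ^+ size s * \prod_(i <- s) F i.
Proof. by rewrite big_split /= big_const_seq count_predT iter_mulr_1. Qed.

(** The bookkeeping of [char_poly_corona] with each power abstracted as one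
    nonzero scalar, which puts it within reach of the field tactic. *)
Lemma cancel_corona_degrees (F : fieldType) (chi D T P2 P3 A N K PT B V PM PE : F) :
    D != 0 -> T != 0 -> P2 != 0 -> P3 != 0 -> A != 0 -> N != 0 -> K != 0 ->
    chi * (D * T * P2 * P3)
      = D / (A * N * K) * PT * (T * B * (P2 * (V * PM) * (P3 * (K * PE)))) ->
  chi * (A * N) = B * V * PM * PE * PT.
Proof.
move=> D0 T0 P20 P30 A0 N0 K0 chiE.
have DT0 : D * T * P2 * P3 != 0 by rewrite !mulf_neq0.
apply: (mulIf DT0); rewrite mulrAC chiE.
by field; rewrite A0 N0 K0.
Qed.

Section CharPoly.
Variables (R : rcfType) (G1 G2 G3 : sgraph) (r1 r2 r3 : nat).
Hypotheses (hr1 : regular G1 r1) (hr2 : regular G2 r2) (hr3 : regular G3 r3).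
Hypothesis r1_gt0 : (0 < r1)%N.
Variables (theta mu eta : seq R).
Hypotheses (htheta : eigenvalues_of (normalized_laplacian R G1) theta)
  (hmu : eigenvalues_of (normalized_laplacian R G2) (rcons mu 0))
  (heta : eigenvalues_of (normalized_laplacian R G3) (rcons eta 0)).

Let C := corona G1 G2 G3.
Let quartic := corona_quartic r1 r2 r3 #|G2| #|G3| : R -> {poly R}.
Let lead := quartic_lead R r1 r2 r3 #|G2| #|G3|.

(** The lists [mu] and [eta] omit one eigenvalue 0 each.  Its factor x - nu,
    resp. x - ka with ka = 1 / (r3 + 1), is proportional to b2, resp. b3, in
    [fdet_corona]; it cancels the denominators of the Schur complement, up to
    the powers of X - 1 and X - nu displayed. *)
Lemma char_poly_corona :
  char_poly (normalized_laplacian R C)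
    * (('X - 1%:P) * ('X - (2 / (r2%:R + 2))%:P)) ^+ #|G1|
  = (('X - 1%:P) * ('X - (2 / (r2%:R + 2))%:P)) ^+ #|edges G1|
    * (\prod_(m <- mu) ('X - ((2 + r2%:R * m) / (r2%:R + 2))%:P)) ^+ #|edges G1|
    * (\prod_(m <- eta) ('X - ((1 + r3%:R * m) / (r3%:R + 1))%:P)) ^+ #|G1|
    * \prod_(t <- theta) (lead^-1 *: quartic t).
Proof.
have e2_neq0 : r2%:R + 2 != 0 :> R by rewrite -natrD pnatr_eq0 addn_eq0 andbF.
have e3_neq0 : r3%:R + 1 != 0 :> R by rewrite natr1 pnatr_eq0.
have lead_neq0 : lead != 0 by exact: quartic_lead_neq0.
pose d : R := r1%:R * #|G2|%:R + #|G3|%:R + r1%:R.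
have d_neq0 : d != 0.
  apply: contraNneq lead_neq0; rewrite /lead /quartic_lead -/d => ->.
  by rewrite mulr0 !mul0r.
pose nu : R := 2 / (r2%:R + 2); pose ka : R := 1 / (r3%:R + 1).
apply: (@poly_eq_off_roots _ _ _ (('X - 1%:P) * ('X - nu%:P) * ('X - ka%:P))).
  by rewrite !mulf_neq0 ?polyXsubC_eq0.
move=> x; rewrite !hornerM !hornerXsubC !mulf_eq0 !negb_or -andbA.
case/and3P=> a_neq0 xnu_neq0 xka_neq0.
rewrite !(horner_exp, hornerM, horner_prod, hornerXsubC) -/nu.
under [X in _ = _ * X ^+ _ * _ * _]eq_bigr do rewrite hornerXsubC.
under [X in _ = _ * X ^+ _ * _]eq_bigr do rewrite hornerXsubC.
under [X in _ = _ * X]eq_bigr do rewrite hornerZ.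
have deg_neq0 (v : C) : degree v != 0%N.
  rewrite -(pnatr_eq0 R) (degree_corona R hr1 hr2 hr3).
  case: v => [[[y|e]|[e p]]|[y q]] //=.
  by rewrite pnatr_eq0.
have b2E : (x - 1) * (r2%:R + 2) + r2%:R = (r2%:R + 2) * (x - nu).
  by rewrite /nu; field.
have b3E : (x - 1) * (r3%:R + 1) + r3%:R = (r3%:R + 1) * (x - ka).
  by rewrite /ka; field.
have := char_poly_laplacian x deg_neq0.
rewrite (fdet_corona hr1 hr2 hr3 htheta hmu heta a_neq0); last 2 first.
- by rewrite b2E mulf_neq0.
- by rewrite b3E mulf_neq0.
have degE : \prod_(v : C) (degree v)%:R = d ^+ #|G1| * 2 ^+ #|edges G1|
    * ((r2%:R + 2) ^+ #|G2|) ^+ #|edges G1| * ((r3%:R + 1) ^+ #|G3|) ^+ #|G1| :> R.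
  under eq_bigr do rewrite (degree_corona R hr1 hr2 hr3).
  rewrite !big_sumType /= !prodr_const !card_prod card_edge_type -/d.
  by rewrite -!exprM [(#|G2| * _)%N]mulnC [(#|G3| * _)%N]mulnC.
(* The last factor, at m = 0, is (r2 + 2) (x - nu). *)
have muE : \prod_(m <- rcons mu 0) ((x - 1) * (r2%:R + 2) + r2%:R * (1 - m))
    = (r2%:R + 2) ^+ #|G2|
      * ((x - nu) * \prod_(m <- mu) (x - (2 + r2%:R * m) / (r2%:R + 2))).
  rewrite -(size_eigenvalues hmu).
  transitivity (\prod_(m <- rcons mu 0)
    ((r2%:R + 2) * (x - (2 + r2%:R * m) / (r2%:R + 2)))).
    by apply: eq_bigr => m _; field.
  by rewrite prodZ_seq big_rcons /= mulr0 addr0 [_ * (x - _)]mulrC.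
have etaE : \prod_(m <- rcons eta 0) ((x - 1) * (r3%:R + 1) + r3%:R * (1 - m))
    = (r3%:R + 1) ^+ #|G3|
      * ((x - ka) * \prod_(m <- eta) (x - (1 + r3%:R * m) / (r3%:R + 1))).
  rewrite -(size_eigenvalues heta).
  transitivity (\prod_(m <- rcons eta 0)
    ((r3%:R + 1) * (x - (1 + r3%:R * m) / (r3%:R + 1)))).
    by apply: eq_bigr => m _; field.
  by rewrite prodZ_seq big_rcons /= mulr0 addr0 [_ * (x - _)]mulrC.
have thetaE : \prod_(t <- theta) ((x - 1) * d - #|G3|%:R / ((x - 1) * (r3%:R + 1) + r3%:R)
      - ((2 * (x - 1))^-1 + #|G2|%:R / ((x - 1) * (r2%:R + 2) + r2%:R)) * r1%:R * (2 - t))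
    = (d / ((x - 1) * (x - nu) * (x - ka))) ^+ #|G1|
      * \prod_(t <- theta) (lead^-1 * (quartic t).[x]).
  rewrite -(size_eigenvalues htheta) -prodZ_seq; apply: eq_bigr => t _.
  set b2 := (x - 1) * (r2%:R + 2) + r2%:R; set b3 := (x - 1) * (r3%:R + 1) + r3%:R.
  have b2_neq0 : b2 != 0 by rewrite /b2 b2E mulf_neq0.
  have b3_neq0 : b3 != 0 by rewrite /b3 b3E mulf_neq0.
  (* The quartic at x is 2 a b2 b3 times the factor E of the Schur complement. *)
  set E := LHS.
  have -> : (quartic t).[x] = 2 * (x - 1) * b2 * b3 * E.
    rewrite /quartic /corona_quartic -!polyC1.
    rewrite !(hornerD, hornerN, hornerM, hornerC, hornerX, horner_exp) /E -/d.
    have -> : (1 + r3%:R) * x - 1 = b3 by rewrite /b3; ring.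
    have -> : (2 + r2%:R) * x - 2 = b2 by rewrite /b2; ring.
    have -> : (2 * #|G2|%:R + r2%:R + 2) * x - (2 * #|G2|%:R + 2)
        = b2 + 2 * #|G2|%:R * (x - 1) by rewrite /b2; ring.
    by field; rewrite b2_neq0 b3_neq0 a_neq0.
  have -> : lead = 2 * d * (r3%:R + 1) * (r2%:R + 2).
    by rewrite /lead /quartic_lead -/d; ring.
  rewrite /b2 b2E /b3 b3E; move: E => E.
  move: (x - 1) (x - nu) (x - ka) a_neq0 xnu_neq0 xka_neq0 => a p q a_neq0 p_neq0 q_neq0.
  by field; rewrite a_neq0 p_neq0 q_neq0 e2_neq0 e3_neq0 d_neq0.
rewrite degE -/d muE etaE thetaE !exprMn exprVn !exprMn.
apply: cancel_corona_degrees; rewrite ?expf_neq0 ?pnatr_eq0 //.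
Qed.
End CharPoly.

(** * From polynomial identities to multisets *)

Lemma roots_of_dvd_split (R : rcfType) (p : {poly R}) (s : seq R) n :
    p %| \prod_(x <- s) ('X - x%:P) -> size p = n.+1 ->
  exists t : n.-tuple R, roots_of p t.
Proof.
move=> /dvdp_prod_XsubC[m p_eqp] sz_p.
have sz_t : size (mask m s) == n.
  by rewrite -eqSS -sz_p (eqp_size p_eqp) size_prod_XsubC.
exists (Tuple sz_t); split; first by rewrite -size_poly_gt0 sz_p.
have := eqp_eq p_eqp.
by rewrite (monicP (monic_prod_XsubC _ _ _)) scale1r.
Qed.

Lemma prod_XsubC_nseq (R : comNzRingType) n (x : R) :
  \prod_(y <- nseq n x) ('X - y%:P) = ('X - x%:P) ^+ n.
Proof. by rewrite big_nseq iter_mulr_1. Qed.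

Lemma prod_XsubC_flatten_nseq (R : comNzRingType) n (s : seq R) (f : R -> R) :
  \prod_(y <- flatten [seq nseq n (f x) | x <- s]) ('X - y%:P)
  = (\prod_(x <- s) ('X - (f x)%:P)) ^+ n.
Proof.
rewrite big_flatten big_map -prodrXl.
by apply: eq_bigr => x _; rewrite prod_XsubC_nseq.
Qed.

(** With truncated subtraction at most one side keeps copies of x and y, which
    expresses a possibly negative multiplicity m - n on the right. *)
Lemma perm_eq_cancel_nseq (T : eqType) (s t : seq T) (x y : T) n m :
    perm_eq (s ++ nseq n x ++ nseq n y) (nseq m x ++ nseq m y ++ t) ->
  perm_eq (s ++ nseq (n - m) x ++ nseq (n - m) y)
          (nseq (m - n) x ++ nseq (m - n) y ++ t).
Proof.
move=> /seq.permP perm_st; apply/seq.permP => P; have := perm_st P.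
rewrite !count_cat !count_nseq; case: (P x); case: (P y); rewrite ?mul1n ?mul0n; lia.
Qed.

Lemma rcons_nth_last0 (R : nmodType) (s : seq R) :
  (0 < size s)%N -> last 0 s = 0 ->
  s = rcons [seq s`_j | j <- iota 0 (size s - 1)] 0.
Proof.
case/lastP: s => // s x _; rewrite last_rcons size_rcons subn1 /= => ->.
congr rcons; rewrite -{1}(mkseq_nth 0 s); apply/eq_in_map => j.
by rewrite mem_iota nth_rcons => /andP[_ ->].
Qed.

Theorem corollary3p4 (R : rcfType) (G1 G2 G3 : sgraph)
    (r1 r2 r3 n1 n2 n3 m1 m2 m3 : nat)
    (hr1 : regular G1 r1) (hr2 : regular G2 r2) (hr3 : regular G3 r3)
    (hn1 : #|G1| = n1) (hn2 : #|G2| = n2) (hn3 : #|G3| = n3)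
    (hm1 : #|edges G1| = m1) (hm2 : #|edges G2| = m2) (hm3 : #|edges G3| = m3)
    (n1_ge1 : (1 <= n1)%N) (n2_ge1 : (1 <= n2)%N) (n3_ge1 : (1 <= n3)%N)
    (r1_ge1 : (1 <= r1)%N)
    (theta : n1.-tuple R) (mu : n2.-tuple R) (eta : n3.-tuple R)
    (htheta : eigenvalues_of (normalized_laplacian R G1) theta)
    (hmu : eigenvalues_of (normalized_laplacian R G2) mu)
    (heta : eigenvalues_of (normalized_laplacian R G3) eta)
    (theta_sorted : sorted >=%R theta)
    (mu_sorted : sorted >=%R mu)
    (eta_sorted : sorted >=%R eta) :
  exists (spec : seq R) (rho : 'I_n1 -> 4.-tuple R),
    [/\ eigenvalues_of (normalized_laplacian R (corona G1 G2 G3)) spec,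
        forall i : 'I_n1,
          roots_of (corona_quartic r1 r2 r3 n2 n3 (tnth theta i)) (rho i)
      & perm_eq
          (spec ++ nseq (n1 - m1) 1 ++ nseq (n1 - m1) (2 / (r2%:R + 2)))
          (flatten [seq nseq m1 ((2 + r2%:R * mu`_j) / (r2%:R + 2))
                   | j <- iota 0 (n2 - 1)]
           ++ flatten [seq nseq n1 ((1 + r3%:R * eta`_k) / (r3%:R + 1))
                      | k <- iota 0 (n3 - 1)]
           ++ nseq (m1 - n1) 1 ++ nseq (m1 - n1) (2 / (r2%:R + 2))
           ++ flatten [seq tval (rho i) | i <- enum 'I_n1])].
Proof.
have mu_last := regular_last_eigenvalue (etrans (congr1 _ hn2) n2_ge1) hr2 hmu mu_sorted.
have eta_last := regular_last_eigenvalue (etrans (congr1 _ hn3) n3_ge1) hr3 heta eta_sorted.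
have muE := rcons_nth_last0 (etrans (congr1 _ (size_tuple mu)) n2_ge1) mu_last.
have etaE := rcons_nth_last0 (etrans (congr1 _ (size_tuple eta)) n3_ge1) eta_last.
rewrite !size_tuple in muE etaE.
set mu' := [seq mu`_j | j <- _] in muE; set eta' := [seq eta`_k | k <- _] in etaE.
rewrite muE in hmu; rewrite etaE in heta.
have := char_poly_corona hr1 hr2 hr3 r1_ge1 htheta hmu heta.
rewrite hn1 hn2 hn3 hm1; set nu := 2 / (r2%:R + 2); set lead := quartic_lead _ _ _ _ _ _.
set quartic := corona_quartic r1 r2 r3 n2 n3 => chiE.
have lead_neq0 : lead != 0 by exact: quartic_lead_neq0.
have [spec specE] := char_poly_sym_splits (normalized_laplacian_sym R (corona G1 G2 G3)).
have spec_split : \prod_(x <- spec ++ nseq n1 1 ++ nseq n1 nu) ('X - x%:P)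
    = char_poly (normalized_laplacian R (corona G1 G2 G3))
      * (('X - 1%:P) * ('X - nu%:P)) ^+ n1.
  by rewrite !big_cat /= !prod_XsubC_nseq specE exprMn.
have [rho rhoP] : exists rho : 'I_n1 -> 4.-tuple R,
    forall i, roots_of (quartic (tnth theta i)) (rho i).
  apply: (@fin_all_exists _ (fun=> 4.-tuple R)
    (fun i t => roots_of (quartic (tnth theta i)) t)) => i.
  apply: (@roots_of_dvd_split _ _ (spec ++ nseq n1 1 ++ nseq n1 nu)).
    rewrite spec_split chiE; apply: dvdp_mull; rewrite big_tuple.
    rewrite (bigD1 i) //= -mul_polyC.
    exact/dvdp_mulr/dvdp_mull/dvdpp.
  by case: (size_lead_corona_quartic r2 r3 n2 n3 (tnth theta i) r1_ge1).
exists spec, rho; split=> //.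
  split; first exact/monic_neq0/char_poly_monic.
  by rewrite (monicP (char_poly_monic _)) scale1r.
set A := flatten _; set B := flatten _; set Q := flatten _.
apply: (@perm_trans _ (nseq (m1 - n1) 1 ++ nseq (m1 - n1) nu ++ A ++ B ++ Q)); last first.
  by apply/seq.permP => P; rewrite !count_cat; lia.
apply/perm_eq_cancel_nseq/prod_XsubC_eq; rewrite spec_split chiE.
rewrite !big_cat /= !prod_XsubC_nseq.
have -> : A = flatten [seq nseq m1 ((2 + r2%:R * m) / (r2%:R + 2)) | m <- mu'].
  by rewrite /A -map_comp.
have -> : B = flatten [seq nseq n1 ((1 + r3%:R * m) / (r3%:R + 1)) | m <- eta'].
  by rewrite /B -map_comp.
rewrite !prod_XsubC_flatten_nseq exprMn -!mulrA; do 4 congr (_ * _).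
rewrite /Q big_flatten big_map big_enum /= big_tuple.
apply: eq_bigr => i _; have [_ {1}->] := rhoP i.
have [_ ->] := size_lead_corona_quartic r2 r3 n2 n3 (tnth theta i) r1_ge1.
by rewrite scalerA mulVf // scale1r.
Qed.
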